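(* Let $n,\delta\in\mathbb{N}$ with $\delta\geq 3$ and $n\geq 8$. If $G$ is a connected $C_4$-free graph of order $n$, minimum degree $\delta$ and diameter $d$, then \[\pi(G)\geq \frac{\left(\delta^2-2\lfloor\frac{\delta}{2}\rfloor +1\right)(d-4)(d-3)}{20(n-1)}.\]
   Context: All graphs are finite and simple. For a connected graph $G$ of order $n\ge 2$ and a vertex $v$, $\overline{\sigma}(v)=\frac{1}{n-1}\sum_{w\in V(G)}d(v,w)$, where $d$ is the shortest-path distance, and the proximity is $\pi(G)=\min_{v\in V(G)}\overline{\sigma}(v)$. A graph is $C_4$-free if it does not contain a $4$-cycle as a (not necessarily induced) subgraph. *)

(* Defs.v *)
From mathcomp Require Import all_boot all_order all_algebra.

Set Implicit Arguments.
Unset Strict Implicit.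
Unset Printing Implicit Defensive.

Import GRing.Theory Num.Theory.

(* A finite simple graph is a symmetric irreflexive relation e on a finType. *)

Definition connected (T : finType) (e : rel T) : Prop :=
  forall x y : T, connect e x y.

(* There is a path (with distinct vertices) with k edges from x to y. *)
Definition joined_by (T : finType) (e : rel T) (k : nat) (x y : T) : bool :=
  [exists p : k.-tuple T,
     [&& path e x p, last x p == y & uniq (x :: p)]].

(* Least k such that joined_by e k x y; paths have fewer than #|T| edges, so
   the search range is exhaustive, and the value is #|T| exactly when y is not
   reachable from x. *)
Definition dist (T : finType) (e : rel T) (x y : T) : nat :=
  find (fun k => joined_by e k x y) (iota 0 #|T|).

Definition diameter (T : finType) (e : rel T) : nat :=
  \max_(x : T) \max_(y : T) dist e x y.

Definition degree (T : finType) (e : rel T) (x : T) : nat :=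
  #|[set y | e x y]|.

(* In the two minima below the initial value of the iteration is the first of
   the values being compared, so for nonempty T it does not affect the result. *)
Definition min_degree (T : finType) (e : rel T) : nat :=
  let s := [seq degree e x | x : T] in
  \big[minn/head 0%N s]_(k <- s) k.

Definition C4_free (T : finType) (e : rel T) : Prop :=
  forall c : 4.-tuple T, ~ ucycle e c.

Local Open Scope ring_scope.

Definition avg_dist (T : finType) (e : rel T) (v : T) : rat :=
  (#|T|%:R - 1)^-1 * \sum_(w : T) (dist e v w)%:R.

Definition proximity (T : finType) (e : rel T) : rat :=
  let s := [seq avg_dist e v | v : T] in
  \big[Num.min/head 0 s]_(r <- s) r.

(* Main.v *)
(* For a vertex v and a shortest path x_0, ..., x_d realising the diameter,
   every vertex w lies within distance 2 of at most five of the x_i, so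
   5 * \sum_w d(v,w) >= \sum_i |B_2(x_i)| * max(0, d(v,x_i) - 2).  In a C4-free
   graph the neighbourhood of a vertex induces a matching and every other vertex
   has at most one neighbour in it, which gives
   |B_2(x)| >= delta^2 - 2 * floor(delta/2) + 1.  Finally pair x_i with x_(d-i),
   using d(v,x_i) + d(v,x_(d-i)) >= |d - 2i|. *)
Require Import Defs.
From mathcomp Require Import all_boot all_order all_algebra.
From mathcomp Require Import zify ring lra.

Set Implicit Arguments.
Unset Strict Implicit.
Unset Printing Implicit Defensive.

Import GRing.Theory Num.Theory.
Local Open Scope ring_scope.

(** * Shortest-path distance as a metric, and geodesics *)

Section Distance.
Local Open Scope nat_scope.
Variables (T : finType) (e : rel T).

Lemma dist_le_size (x : T) (p : seq T) : path e x p -> dist e x (last x p) <= size p.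
Proof.
move=> /shortenP[q eq_q uniq_q sub_qp].
have uq : uniq q by move: uniq_q => /= /andP[].
apply: leq_trans (uniq_leq_size uq sub_qp).
rewrite leqNgt; apply/negP => lt_q; have /= le_q : size (x :: q) <= #|T|.
  by rewrite -(card_uniqP uniq_q) max_card.
have := before_find 0 lt_q; rewrite nth_iota // add0n => /negbT/negP; apply.
apply/existsP; exists (in_tuple q).
by rewrite eq_q eqxx.
Qed.

Lemma dist_path (x y : T) : connect e x y ->
  exists p, [/\ path e x p, last x p = y & size p = dist e x y].
Proof.
move=> /connectP[p0 + ->] => /shortenP[p ep up _].
have le_p : size (x :: p) <= #|T| by rewrite -(card_uniqP up) max_card.
have : has (fun k => joined_by e k x (last x p)) (iota 0 #|T|).
  apply/hasP; exists (size p); first by rewrite mem_iota.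
  by apply/existsP; exists (in_tuple p); rewrite ep eqxx.
move=> h; have := nth_find 0 h; rewrite has_find size_iota in h.
rewrite nth_iota // add0n => /existsP[q /and3P[eq_q /eqP lq _]].
by exists q; rewrite size_tuple.
Qed.

Lemma dist_xx (x : T) : dist e x x = 0.
Proof. by apply/eqP; rewrite -leqn0; apply: (@dist_le_size x [::]). Qed.

Lemma dist_gt0 (x y : T) : connect e x y -> x != y -> 0 < dist e x y.
Proof.
move=> /dist_path[p [_ lp <-]]; case: p lp => //= ->; by rewrite eqxx.
Qed.

Hypothesis econn : connected e.

Lemma dist_triangle (x y z : T) : dist e x z <= dist e x y + dist e y z.
Proof.
have [p [ep lp <-]] := dist_path (econn x y).
have [q [eq_q lq <-]] := dist_path (econn y z).
have := @dist_le_size x (p ++ q); rewrite cat_path ep last_cat lp lq size_cat.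
exact.
Qed.

Hypothesis esym : symmetric e.

Lemma dist_leC (x y : T) : dist e x y <= dist e y x.
Proof.
have [p [ep lp <-]] := dist_path (econn y x).
have := @dist_le_size x (rev (belast y p)); rewrite size_rev size_belast.
have -> : last x (rev (belast y p)) = y.
  case: p {ep} lp => [|a p] /= lp; first by rewrite lp.
  by rewrite rev_cons last_rcons.
apply; rewrite -lp rev_path (eq_path (e' := e)) // => a b; exact: esym.
Qed.

Lemma dist_sym (x y : T) : dist e x y = dist e y x.
Proof. by apply/eqP; rewrite eqn_leq !dist_leC. Qed.

(** Take for [f i] the [i]-th vertex of a shortest path. It is within [i] of [x], and [f j] is
    within [dist e x y - j] of [y], so a smaller distance between them would shorten the path. *)
Lemma geodesic (x y : T) : exists f : nat -> T,
  forall i j, i <= j <= dist e x y -> j - i <= dist e (f i) (f j).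
Proof.
have [p [ep lp szp]] := dist_path (econn x y).
exists (fun i => last x (take i p)) => i j /andP[le_ij le_j].
have le_xi : dist e x (last x (take i p)) <= i.
  apply: leq_trans (dist_le_size (take_path i ep)) _.
  by rewrite size_take; case: ifP => // /negbT; lia.
have le_jy : dist e (last x (take j p)) y <= dist e x y - j.
  rewrite -szp -size_drop -lp -{2}(cat_take_drop j p) last_cat.
  by apply: dist_le_size; move: ep; rewrite -{1}(cat_take_drop j p) cat_path => /andP[].
have := dist_triangle x (last x (take i p)) y.
have := dist_triangle (last x (take i p)) (last x (take j p)) y.
lia.
Qed.

End Distance.

(** * Balls of radius two in C4-free graphs *)

Section C4Free.
Local Open Scope nat_scope.
Variables (T : finType) (e : rel T).
Hypotheses (esym : symmetric e) (eirr : irreflexive e) (eC4 : C4_free e).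

(** Two common neighbours [a], [b] would close the 4-cycle [x, a, y, b]. *)
Lemma card_common_nbrs (x y : T) : x != y -> #|[set z | e x z & e y z]| <= 1.
Proof.
move=> xy; rewrite leqNgt; apply/negP => /card_gt1P[a [b [+ + ab]]].
rewrite !inE => /andP[xa ya] /andP[xb yb].
have neq u v : e u v -> u != v by apply: contraTneq => ->; rewrite eirr.
apply: (eC4 (c := [tuple x; a; y; b])).
rewrite /ucycle /= !inE !negb_or xa (esym a y) ya yb (esym b x) xb.
by rewrite xy ab !neq // esym.
Qed.

Lemma card_nbrs_in (A : {set T}) (x : T) :
  #|[set w in A | e x w]| = \sum_(w in A) e x w.
Proof.
rewrite -sum1_card (eq_bigl (fun w => (w \in A) && e x w)) => [|w]; last by rewrite inE.
by rewrite big_mkcondr; apply: eq_bigr => w _; case: (e x w).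
Qed.

(** Each new vertex adds its edges to the earlier ones twice, by symmetry, and no loop. *)
Lemma handshake (s : seq T) : ~~ odd (\sum_(u <- s) \sum_(w <- s) e u w).
Proof.
elim: s => [|a s IHs]; first by rewrite big_nil.
rewrite big_cons big_cons eirr.
under [X in _ + X]eq_bigr => u _ do rewrite big_cons esym.
by rewrite big_split /= addnA addnn oddD odd_double.
Qed.

Variable delta : nat.
Hypotheses (delta_ge2 : 1 < delta) (delta_le : forall x, delta <= degree e x).

Lemma card_ball2 (x : T) : connected e ->
  delta ^ 2 + 1 <= #|[set w | dist e x w <= 2]| + 2 * (delta %/ 2).
Proof.
move=> econn; set N := [set y | e x y]; set B := [set w | _].
have degN : delta <= #|N| := delta_le x.
have xN : x \notin N by rewrite inE eirr.
have dist2 u w : e x u -> e u w -> dist e x w <= 2.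
  move=> xu uw; have := @dist_le_size _ e x [:: u; w].
  by rewrite /= xu uw; apply.
have dist1 u : e x u -> dist e x u <= 2.
  move=> xu; have := @dist_le_size _ e x [:: u].
  by rewrite /= xu => /(_ isT); lia.
pose C := B :\: (x |: N).
have cardB : #|B| = 1 + #|N| + #|C|.
  have sub : x |: N \subset B.
    by apply/subsetP => u; rewrite !inE => /orP[/eqP->|/dist1//]; rewrite dist_xx.
  have -> : 1 + #|N| = #|x |: N| by rewrite cardsU1 xN.
  by rewrite /C cardsD (setIidPr sub) subnKC // subset_leq_card.
(* [W] is twice the number of edges inside [N]: it is even, and at most [#|N|] because these edges
   form a matching. *)
pose W := \sum_(u in N) #|[set w in N | e u w]|.
have evenW : ~~ odd W.
  rewrite /W; under eq_bigr do rewrite card_nbrs_in -big_enum.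
  by rewrite -big_enum; apply: handshake.
have leW : W <= #|N|.
  rewrite -sum1_card; apply: leq_sum => u; rewrite inE => xu.
  have -> : [set w in N | e u w] = [set w | e x w & e u w] by apply/setP => w; rewrite !inE.
  by apply: card_common_nbrs; apply: contraTneq xu => ->; rewrite eirr.
have nbrs u : u \in N -> delta - 1 <= #|[set w in N | e u w]| + #|[set w in C | e u w]|.
  rewrite inE => xu.
  have := delta_le u; rewrite /degree.
  have sub : [set y | e u y] \subset x |: ([set w in N | e u w] :|: [set w in C | e u w]).
    apply/subsetP => w; rewrite !inE => uw; rewrite uw !andbT (dist2 u) //.
    by case: (w == x); case: (e x w).
  have := subset_leq_card sub; rewrite cardsU1.
  have [] := leq_card_setU [set w in N | e u w] [set w in C | e u w].
  by case: (_ \notin _) => /=; lia.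
(* Count the edges between [N] and [C] from the side of [C]: each [w] there shares at most one
   neighbour with [x]. *)
have leC : \sum_(u in N) #|[set w in C | e u w]| <= #|C|.
  under eq_bigr do rewrite card_nbrs_in.
  rewrite exchange_big -sum1_card; apply: leq_sum => w; rewrite !inE negb_or => /andP[/andP[wx _] _].
  under eq_bigr do rewrite esym.
  rewrite -card_nbrs_in.
  have -> : [set u in N | e w u] = [set u | e x u & e w u] by apply/setP => u; rewrite !inE.
  by apply: card_common_nbrs; rewrite eq_sym.
have : #|N| * (delta - 1) <= W + #|C|.
  apply: leq_trans (leq_add (leqnn W) leC).
  by rewrite -big_split -sum_nat_const; apply: leq_sum.
have [h eqW] : exists h, W = h.*2.
  by exists W./2; rewrite -{1}(odd_double_half W) (negbTE evenW).
rewrite cardB; move: leW degN; rewrite eqW; move: #|N| #|C| => D c hD dD hc.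
have eDd : D * (delta - 1) + D = D * delta by rewrite -{2}(subnK (ltnW delta_ge2)) mulnDr muln1.
rewrite expnS expn1.
(* If [D = delta], evenness sharpens [W <= D] to [h <= delta %/ 2]. If [D > delta], [W <= D] alone
   gives a ball of at least [1 + D * (delta - 1) >= delta ^ 2] vertices, and [2 * (delta %/ 2) >= 1]
   supplies the rest. *)
have [eqD|ltD] : D = delta \/ delta < D by lia.
  by rewrite eqD in hD hc eDd *; lia.
have : delta.+1 * (delta - 1) <= D * (delta - 1) by rewrite leq_mul2r ltD orbT.
have : delta.+1 * (delta - 1) + 1 = delta * delta by nia.
lia.
Qed.

End C4Free.

(** * Sums over the indices of a geodesic *)

Section Sums.
Local Open Scope nat_scope.

(** With truncated subtraction, [(d - i - i) + (i - (d - i))] is $|d-2i|$. Removing both end terms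
    leaves the same sum for [d - 2], hence an induction in steps of two. *)
Lemma leq_sum_spread (d : nat) :
  (d - 3) * (d - 4) <= 2 * \sum_(0 <= i < d.+1) ((d - i - i) + (i - (d - i)) - 4).
Proof.
have [k] := ubnP d; elim: k d => // k IHk [|[|d]] lt_dk; [by []|by []|].
rewrite big_nat_recl // big_nat_recr //=.
rewrite (eq_big_nat _ _ (F2 := fun i => (d - i - i) + (i - (d - i)) - 4)); last by move=> i; lia.
have := IHk d ltac:(lia); move: (\sum_(_ <= _ < _) _) => S.
case: d {IHk} lt_dk => [|[|[|[|d]]]] lt_dk; try lia.
rewrite (_ : d.+4 - 3 = d.+1) 1?(_ : d.+4 - 4 = d); [|lia..].
by rewrite (_ : d.+2.+4 - 3 = d.+3) 1?(_ : d.+2.+4 - 4 = d.+2); [nia|lia..].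
Qed.

Lemma leq_spread (d : nat) (a : nat -> nat) :
    (forall i j, i <= j <= d -> j - i <= a i + a j) ->
  (d - 3) * (d - 4) <= 4 * \sum_(0 <= i < d.+1) (a i - 2).
Proof.
move=> ha; apply: leq_trans (leq_sum_spread d) _.
(* Reversing one of two copies of the sum pairs [i] with [d - i]; the two terms of a pair add up to
   at least $|d-2i|-4$. *)
have -> : 4 * \sum_(0 <= i < d.+1) (a i - 2) =
    2 * \sum_(0 <= i < d.+1) ((a i - 2) + (a (d - i) - 2)).
  rewrite big_split /= [X in _ = 2 * (_ + X)]big_nat_rev /=.
  rewrite (eq_big_nat _ _ (F1 := fun i => a (d - _) - 2) (F2 := fun i => a i - 2));
    first by lia.
  by move=> i hi; congr (a _ - _); lia.
rewrite leq_mul2l /= !big_nat; apply: leq_sum => i hi.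
by have := ha i (d - i); have := ha (d - i) i; lia.
Qed.

(** All indices satisfying [P] lie in the window of length 5 that starts at the least of them. *)
Lemma count_close_indices (d : nat) (P : pred nat) :
    (forall i j, i <= j < d -> P i -> P j -> j <= i + 4) ->
  \sum_(0 <= i < d) P i <= 5.
Proof.
move=> hP; case: (pickP (fun i : 'I_d => P i)) => [i0 Pi0|noP]; last first.
  by rewrite big_mkord big1 // => i _; rewrite noP.
have exP : exists i, (i < d) && P i by exists i0; rewrite ltn_ord.
have [m /andP[ltm Pm] minm] := ex_minnP exP.
apply: leq_trans (_ : \sum_(0 <= i < d) (m <= i < m + 5) <= 5).
  rewrite big_nat [leqRHS]big_nat; apply: leq_sum => i hi.
  case Pi: (P i) => //; have := minm i; have := hP m i; rewrite Pi; lia.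
have : \sum_(0 <= i < d) (m <= i < m + 5) <= minn d (m + 5) - m.
  elim: d {hP i0 Pi0 exP ltm Pm minm} => [|d IHd]; first by rewrite big_geq.
  by rewrite big_nat_recr //=; lia.
lia.
Qed.

End Sums.

(** * Lower bounds for the sum of distances from a vertex *)

Section DistanceSum.
Local Open Scope nat_scope.
Variables (T : finType) (e : rel T).
Hypotheses (esym : symmetric e) (econn : connected e).

Lemma total_dist_ge (M : nat) (v : T) :
    (forall x, M <= #|[set w | dist e x w <= 2]|) ->
  M * ((diameter e - 3) * (diameter e - 4)) <= 20 * \sum_w dist e v w.
Proof.
move=> hM; set d := diameter e.
have [x [y dxy]] : exists x y, dist e x y = d.
  have T_gt0 : 0 < #|T| by apply/card_gt0P; exists v.
  have [x dx] := eq_bigmax (fun x => \max_y dist e x y) T_gt0.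
  have [y dy] := eq_bigmax (fun y => dist e x y) T_gt0.
  by exists x, y; rewrite -dy -dx.
have [f hf] := geodesic econn x y; rewrite dxy in hf.
(* Two geodesic vertices within 2 of [w] are within 4 of each other, so their indices differ by at
   most 4. *)
have close w : \sum_(0 <= i < d.+1) (dist e (f i) w <= 2) <= 5.
  apply: count_close_indices => i j ij iw jw.
  have := hf i j; have := dist_triangle econn (f i) w (f j).
  by rewrite (dist_sym econn esym w (f j)); lia.
have spread : (d - 3) * (d - 4) <= 4 * \sum_(0 <= i < d.+1) (dist e v (f i) - 2).
  apply: (@leq_spread d (fun i => dist e v (f i))) => i j /hf hij.
  apply: leq_trans hij _; rewrite (dist_sym econn esym v (f i)).
  exact: dist_triangle.
(* Double counting: each of the at least [M] vertices [w] near [f i] has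
   [dist e v w >= dist e v (f i) - 2], and each [w] is charged at most 5 times. *)
have balls : M * \sum_(0 <= i < d.+1) (dist e v (f i) - 2) <= 5 * \sum_w dist e v w.
  rewrite !big_distrr /=.
  apply: (@leq_trans (\sum_w \sum_(0 <= i < d.+1) (dist e (f i) w <= 2) * dist e v w)).
    rewrite exchange_big /=; apply: leq_sum => i _.
    apply: leq_trans (leq_mul (hM (f i)) (leqnn _)) _.
    rewrite -sum1_card big_distrl big_mkcond /=; apply: leq_sum => w _.
    have := dist_triangle econn v w (f i).
    by rewrite inE (dist_sym econn esym w (f i)); case: (leqP (dist e (f i) w)); lia.
  by apply: leq_sum => w _; rewrite -big_distrl /= leq_mul2r close orbT.
have := leq_mul (leqnn M) spread; lia.
Qed.

Lemma card_le_total_dist (v : T) : #|T| - 1 <= \sum_w dist e v w.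
Proof.
rewrite -cardsT (cardsD1 v) inE addKn -sum1_card big_mkcond.
apply: leq_sum => w _; rewrite !inE andbT; case: eqP => //= /eqP wv.
by apply: dist_gt0; rewrite // eq_sym.
Qed.

End DistanceSum.

(** * Minima over vertices, and the proximity bound *)

Lemma min_degree_le (T : finType) (e : rel T) (x : T) : (min_degree e <= degree e x)%N.
Proof.
rewrite /min_degree; move: (head _ _) => z.
have : degree e x \in [seq degree e x | x : T] by apply: map_f; rewrite mem_enum.
elim: [seq _ | _ : _] => //= a s IHs; rewrite inE big_cons geq_min.
by case/orP => [/eqP->|/IHs->]; rewrite ?leqnn ?orbT.
Qed.

Lemma proximity_ge (T : finType) (e : rel T) (c : rat) :
  (0 < #|T|)%N -> (forall v, c <= avg_dist e v) -> c <= proximity e.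
Proof.
move=> T_gt0 hc; rewrite /proximity.
have hs r : r \in [seq avg_dist e v | v : T] -> c <= r by case/mapP => v _ ->.
have hhd : c <= head 0 [seq avg_dist e v | v : T].
  apply: hs; have : (0 < size [seq avg_dist e v | v : T])%N by rewrite size_map -cardE.
  by case: [seq _ | _ : _] => //= a s _; rewrite inE eqxx.
(* The initial value is generalised to any [z >= c], since the head changes along the induction. *)
elim: [seq _ | _ : _] hs (head _ _) hhd => [|a s IHs] hs z hz; first by rewrite big_nil.
rewrite big_cons Order.TotalTheory.le_min hs ?mem_head // IHs // => r rs.
by apply: hs; rewrite inE rs orbT.
Qed.

Theorem theorem4p5 (n delta d : nat) (T : finType) (e : rel T)
    (hdelta : (3 <= delta)%N) (hn : (8 <= n)%N)
    (esym : symmetric e) (eirr : irreflexive e)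
    (econn : connected e) (eC4 : C4_free e)
    (horder : #|T| = n) (hmindeg : min_degree e = delta)
    (hdiam : diameter e = d) :
  proximity e >=
    (delta%:R ^+ 2 - 2 * (delta %/ 2)%N%:R + 1) * (d%:R - 4) * (d%:R - 3)
      / (20 * (n%:R - 1)).
Proof.
apply: proximity_ge => [|v]; first by rewrite horder; lia.
have [M eM] : exists M, (M + 2 * (delta %/ 2) = delta ^ 2 + 1)%N.
  by exists (delta ^ 2 + 1 - 2 * (delta %/ 2))%N; rewrite subnK // expnS expn1; nia.
have ball x : (M <= #|[set w | dist e x w <= 2]|)%N.
  rewrite -(leq_add2r (2 * (delta %/ 2))) eM.
  by apply: card_ball2 => // [|y]; [apply: ltnW | rewrite -hmindeg min_degree_le].
have -> : delta%:R ^+ 2 - 2 * (delta %/ 2)%N%:R + 1 = M%:R :> rat.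
  have : (M + 2 * (delta %/ 2))%:R = (delta ^ 2 + 1)%:R :> rat by rewrite eM.
  by rewrite natrD natrM natrD natrX; lra.
rewrite /avg_dist horder -natr_sum.
have := total_dist_ge esym econn v ball; have := card_le_total_dist econn v.
have leMn : (M <= n)%N by rewrite -horder; apply: leq_trans (ball v) (max_card _).
rewrite hdiam horder; move: (\sum_w _)%N => S hS1 hS2.
have n_gt1 : 0 < n%:R - 1 :> rat by rewrite subr_gt0 ltr1n; lia.
suff main : M%:R * (d%:R - 4) * (d%:R - 3) <= 20 * S%:R :> rat.
  rewrite ler_pdivrMr ?mulr_gt0 //.
  by rewrite [X in _ <= X](_ : _ = 20 * S%:R) //; field; rewrite lt0r_neq0.
(* From 4 on, truncated and rational subtraction agree. Below 4 the truncated product vanishes, but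
   the rational $(d-4)(d-3)$ is at most 12; then [M <= n] and [n - 1 <= S] suffice, as $12n \le
   20(n-1)$ for $n \ge 8$. *)
have [d_ge4|d_lt4] := leqP 4 d.
  have := hS2; rewrite -(ler_nat rat) !natrM !natrB //; last by lia.
  by rewrite -mulrA [(_ - 4) * _]mulrC.
have {leMn} leMn : M%:R <= n%:R :> rat by rewrite ler_nat.
have {hS1} hS1 : n%:R <= S%:R + 1 :> rat by rewrite natr1 ler_nat; lia.
have {hn} hn : 8 <= n%:R :> rat by rewrite ler_nat.
by case: d d_lt4 {hdiam hS2} => [|[|[|[|d]]]] // _; lra.
Qed.
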